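(* Let $n\ge 3$, $0<T\le\infty$ and $1\le p<\infty$. There exists a boundary datum $g=(g_1,\dots,g_n)\in L^p(\mathbf{R}^{n-1}\times(0,T))\cap L^\infty(\mathbf{R}^{n-1}\times(0,T))$ such that the velocity $u=(u^1,\dots,u^n)$ of the nonstationary Stokes flow in the half space $\mathbf{R}^n_+\times(0,T)$ with boundary data $g$ and zero initial data, given by $$u^i(x,t)=\sum_{j=1}^{n}\int_0^t\int_{\mathbf{R}^{n-1}}K_{ij}(x'-y',x_n,t-s)\,g_j(y',s)\,dy'\,ds,\qquad 1\le i\le n,$$ blows up, i.e. $u\notin L^\infty(\mathbf{R}^n_+\times(0,T))$.
   Context: Write $x=(x',x_n)$ with $x'\in\mathbf{R}^{n-1}$, $\mathbf{R}^n_+=\{x\in\mathbf{R}^n: x_n>0\}$, and $D_{x_i}=\partial/\partial x_i$. Let $\omega_n$ be the measure of the unit sphere in $\mathbf{R}^n$ and set $$E(x)=-\frac{1}{(n-2)\omega_n}\frac{1}{|x|^{n-2}},\qquad \Gamma(x,t)=\frac{1}{\sqrt{2\pi t}^{\,n}}e^{-|x|^2/(2t)}\ (t>0),\quad \Gamma(x,t)=0\ (t<0).$$ The Poisson kernel is $$K_{ij}(x',x_n,t)=-2\delta_{ij}D_{x_n}\Gamma(x',x_n,t)-L_{ij}(x',x_n,t)+\delta_{jn}\,\delta(t)\,D_{x_i}E(x',x_n),$$ $$L_{ij}(x,t)=D_{x_j}\int_0^{x_n}\int_{\mathbf{R}^{n-1}}D_{z_n}\Gamma(z,t)\,D_{x_i}E(x-z)\,dz'\,dz_n,$$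 where $\delta_{ij}$ is the Kronecker delta and $\delta(t)$ is the Dirac delta in time; the term with $\delta(t)$ contributes $\int_{\mathbf{R}^{n-1}}D_{x_i}E(x'-y',x_n)g_n(y',t)\,dy'$ to $u^i(x,t)$. *)

(* Defs.v *)
From HB Require Import structures.
From mathcomp Require Import all_boot all_order all_algebra.
From mathcomp Require Import all_classical all_reals all_analysis.

Set Implicit Arguments.
Unset Strict Implicit.
Unset Printing Implicit Defensive.

Import Order.TTheory GRing.Theory Num.Theory.
Import numFieldNormedType.Exports.

Local Open Scope classical_set_scope.
Local Open Scope ring_scope.

Section LebesgueTuple.
Variable R : realType.

(* The point (x', s) of R^(m+1), for x' in R^m and s in R. *)
Definition snoc (m : nat) (p : m.-tuple R * R) : m.+1.-tuple R :=
  [tuple of rcons p.1 p.2].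

Lemma measurable_snoc m : measurable_fun [set: m.-tuple R * R] (@snoc m).
Proof.
apply/measurable_fun_tnthP => i.
have [im|mi] := ltnP i m.
  rewrite (_ : _ \o _ = (fun x => tnth x (Ordinal im)) \o fst); last first.
    apply/funext => p /=.
    by rewrite !(tnth_nth 0) /= nth_rcons size_tuple im.
  by apply: measurableT_comp => //; exact: measurable_tnth.
rewrite (_ : _ \o _ = snd) //; apply/funext => p /=.
have -> : i = ord_max.
  by apply/val_inj/eqP; rewrite /= eqn_leq mi -ltnS ltn_ord.
by rewrite (tnth_nth 0) /= nth_rcons size_tuple ltnn eqxx.
Qed.

Definition unsnoc (m : nat) (x : m.+1.-tuple R) : m.-tuple R * R :=
  ([tuple tnth x (widen_ord (leqnSn m) i) | i < m], tnth x ord_max).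

Lemma snocK m : cancel (@snoc m) (@unsnoc m).
Proof.
move=> [x' s]; congr (_, _).
  apply: eq_from_tnth => i; rewrite tnth_mktuple !(tnth_nth 0) /=.
  by rewrite nth_rcons size_tuple ltn_ord.
by rewrite (tnth_nth 0) /= nth_rcons size_tuple ltnn eqxx.
Qed.

Lemma measurable_unsnoc m : measurable_fun [set: m.+1.-tuple R] (@unsnoc m).
Proof.
apply/measurable_fun_pairP; split; last exact: measurable_tnth.
apply/measurable_fun_tnthP => i.
rewrite (_ : _ \o _ = fun x => tnth x (widen_ord (leqnSn m) i)).
  exact: measurable_tnth.
by apply/funext => x; rewrite /= tnth_mktuple.
Qed.

Definition snoc_measure m (mu : {sigma_finite_measure set (m.-tuple R) -> \bar R}) :=
  pushforward (mu \x @lebesgue_measure R)%E (@snoc m).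

Section SnocMeasure.
Variables (m : nat) (mu : {sigma_finite_measure set (m.-tuple R) -> \bar R}).

Let mpre A : measurable A -> measurable (@snoc m @^-1` A).
Proof. by move=> mA; rewrite -[X in measurable X]setTI; exact: measurable_snoc. Qed.

Let snoc_measure0 : snoc_measure mu set0 = 0%E.
Proof. by rewrite /snoc_measure /pushforward preimage_set0 measure0. Qed.

Let snoc_measure_ge0 A : (0 <= snoc_measure mu A)%E.
Proof. by rewrite /snoc_measure /pushforward; exact: measure_ge0. Qed.

Let snoc_measure_sigma_additive : semi_sigma_additive (snoc_measure mu).
Proof.
move=> F mF tF mUF; rewrite /snoc_measure /pushforward preimage_bigcup.
apply: measure_semi_sigma_additive.
- by move=> k; exact: mpre.
- apply/trivIsetP => /= i j _ _ ij; rewrite -preimage_setI.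
  by move/trivIsetP : tF => /(_ _ _ _ _ ij) ->//; rewrite preimage_set0.
- by rewrite -preimage_bigcup; exact: mpre.
Qed.

HB.instance Definition _ := isMeasure.Build _ _ _ (snoc_measure mu)
  snoc_measure0 snoc_measure_ge0 snoc_measure_sigma_additive.

Let snoc_measure_sigma_finite : sigma_finite setT (snoc_measure mu).
Proof.
have /sigma_finiteP[F [TF ndF Foo]] := sigma_finiteT mu.
have /sigma_finiteP[G [TG ndG Goo]] := sigma_finiteT (@lebesgue_measure R).
exists (fun k => @unsnoc m @^-1` (F k `*` G k)).
  apply/seteqP; split => // x _ /=.
  have [k _ Fk] : (\bigcup_k F k) (unsnoc x).1 by rewrite -TF.
  have [l _ Gl] : (\bigcup_l G l) (unsnoc x).2 by rewrite -TG.
  exists (maxn k l) => //; split.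
    by move: Fk; exact/subsetPset/ndF/leq_maxl.
  by move: Gl; exact/subsetPset/ndG/leq_maxr.
move=> k; have [mF Fk] := Foo k; have [mG Gk] := Goo k; split.
  rewrite -[X in measurable X]setTI; apply: measurable_unsnoc => //.
  exact: measurableX.
rewrite /snoc_measure /pushforward -comp_preimage.
rewrite (_ : _ \o _ = id); last by apply/funext => p /=; rewrite snocK.
by rewrite preimage_id product_measure1E// lte_mul_pinfty// ge0_fin_numE.
Qed.

HB.instance Definition _ := Measure_isSigmaFinite.Build _ _ _ (snoc_measure mu)
  snoc_measure_sigma_finite.

End SnocMeasure.

(* Lebesgue measure on R^m: R^0 is a point of mass 1, and R^(m+1) is the
   product of R^m and R, identified through [snoc]. *)
Fixpoint lebesgueT (m : nat) :
    {sigma_finite_measure set (m.-tuple R) -> \bar R} :=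
  match m with
  | 0 => dirac [tuple]
  | k.+1 => snoc_measure (lebesgueT k)
  end.

End LebesgueTuple.
Arguments lebesgueT {R} m.

Section Kernels.
Variable R : realType.
Local Notation leb := (@lebesgue_measure R).

Definition subT n (x z : n.-tuple R) : n.-tuple R :=
  [tuple tnth x i - tnth z i | i < n].

Definition enorm n (x : n.-tuple R) : R :=
  Num.sqrt (\sum_(i < n) tnth x i ^+ 2).

Definition set_coord n (x : n.-tuple R) (i : 'I_n) (s : R) : n.-tuple R :=
  [tuple if j == i then s else tnth x j | j < n].

Definition partial n (i : 'I_n) (f : n.-tuple R -> R) (x : n.-tuple R) : R :=
  derive1 (fun s : R => f (set_coord x i s)) (tnth x i).

(* Surface measure of A, a subset of the unit sphere: n times the Lebesgue
   measure of the cone {r y : 0 < r <= 1, y in A}. *)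
Definition sphere_measure n (A : set (n.-tuple R)) : \bar R :=
  (n%:R%:E * lebesgueT n
    [set x | exists r : R, exists2 y, A y &
       (0 < r <= 1)%R /\ x = [tuple (r * tnth y i)%R | i < n]])%E.

Definition omega n : R := fine (sphere_measure [set y : n.-tuple R | enorm y = 1]).

Definition Esol n (x : n.-tuple R) : R :=
  - (1 / ((n%:R - 2) * omega n)) * (1 / enorm x ^+ (n - 2)).

Definition Gam n (x : n.-tuple R) (t : R) : R :=
  if 0 < t then
    1 / Num.sqrt (2 * pi * t) ^+ n * expR (- (enorm x ^+ 2) / (2 * t))
  else 0.

(* From here on the space dimension is n = m + 1; [ord_max] is the index of the
   normal coordinate x_n. *)
Definition Lker m (i j : 'I_m.+1) (x : m.+1.-tuple R) (t : R) : R :=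
  partial j (fun y : m.+1.-tuple R =>
    \int[leb]_(zn in `[0, tnth y ord_max])
      \int[lebesgueT m]_z'
        (partial ord_max (fun z => Gam z t) (snoc (z', zn)) *
         partial i (@Esol m.+1) (subT y (snoc (z', zn))))) x.

(* K_ij without its term carrying the Dirac delta in time. *)
Definition Kreg m (i j : 'I_m.+1) (x : m.+1.-tuple R) (t : R) : R :=
  - 2 * (i == j)%:R * partial ord_max (fun z => Gam z t) x - Lker i j x t.

(* The velocity at x = (x', x_n) and time t, as a function of ((x', x_n), t);
   the term delta_jn delta(t) D_i E of K_ij contributes the second integral. *)
Definition velocity m (g : 'I_m.+1 -> m.-tuple R * R -> R) (i : 'I_m.+1)
    (z : (m.-tuple R * R) * R) : R :=
  let: ((x', xn), t) := z in
  \sum_(j < m.+1)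
    ((\int[leb]_(s in `]0, t[) \int[lebesgueT m]_y'
        (Kreg i j (snoc (subT x' y', xn)) (t - s) * g j (y', s)))
     + (j == ord_max)%:R *
       \int[lebesgueT m]_y'
         (partial i (@Esol m.+1) (snoc (subT x' y', xn)) * g j (y', t))).

Definition boundary_cyl m (T : \bar R) : set (m.-tuple R * R) :=
  [set z | 0 < z.2 /\ (z.2%:E < T)%E].

Definition halfspace_cyl m (T : \bar R) : set ((m.-tuple R * R) * R) :=
  [set z | 0 < z.1.2 /\ 0 < z.2 /\ (z.2%:E < T)%E].

(* f restricted to D is in L^p(D, mu): its extension by 0 is in L^p(mu). *)
Definition in_Lp d (X : measurableType d) (mu : {measure set X -> \bar R})
    (D : set X) (p : \bar R) (f : X -> R) : Prop :=
  patch (fun=> 0) D f \in Lfun mu p.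

End Kernels.

(* Main.v *)
(** The datum is purely normal, g_n(y, s) = 1_Q(y) 1_(0,1)(s) with
    Q = [-2, 0)^(n-1), and the component that blows up is tangential. For a
    tangential index i and 0 < t < 1 the velocity is

      u^i(x, t) = int_0^t k_x(t - r) dr + W(x),
      W(x) = int_Q D_i E(x' - y', x_n) dy',

    where k_x comes from the kernel without its Dirac term. For fixed x the
    first summand tends to 0 as t -> 0+, so that |u^i| <= M almost everywhere
    forces W(x) <= M + 1 for almost every x. But W is unbounded: the dyadic
    cubes [-2 2^(-k), -2^(-k))^(n-1), k < N, are disjoint subsets of Q and by
    homogeneity each contributes at least a fixed constant to W(x) when x lies
    in the cube [0, 2^(-N))^n.

    Nothing has to be known about L_ij for the first summand: if k_x is not
    integrable near 0, the time integral is infinite for every t and its real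
    value is 0 by convention. Not even measurability of k_x is needed, because
    the integral of a nonnegative function is a supremum over simple functions
    below it. *)
Require Import Defs.
From HB Require Import structures.
From mathcomp Require Import all_boot all_order all_algebra.
From mathcomp Require Import all_classical all_reals all_analysis.
From mathcomp Require Import measurable_realfun ess_sup_inf ring lra.

Set Implicit Arguments.
Unset Strict Implicit.
Unset Printing Implicit Defensive.

Import Order.TTheory GRing.Theory Num.Theory.
Import numFieldNormedType.Exports.

Local Open Scope classical_set_scope.
Local Open Scope ring_scope.

(** * Lower integrals of arbitrary nonnegative functions *)

Section LowerIntegral.
Context d (X : measurableType d) (R : realType).
Variable mu : {measure set X -> \bar R}.
Local Open Scope ereal_scope.
Import HBNNSimple.

(** Every simple function below [f1] is also below [f2], so the supremum can only grow. The
    integrands may be arbitrary nonnegative functions. *)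
Lemma le_ge0_integral (f1 f2 : X -> \bar R) :
  (forall x, 0 <= f1 x) -> (forall x, f1 x <= f2 x) ->
  \int[mu]_x f1 x <= \int[mu]_x f2 x.
Proof.
move=> f10 f12; rewrite !ge0_integralTE//; last first.
  by move=> x; exact: le_trans (f12 x).
apply: le_ereal_sup => _ [h hf <-]; exists h => // x.
exact: le_trans (hf x) (f12 x).
Qed.

(** Superadditivity of the lower integral: a simple [g] below [f] gives the simple [g + h] below
    [f + h]. Finiteness of the integral of [h] lets it be moved across the inequality before taking
    the supremum over [g]. *)
Lemma integralD_nnsfun_le (f : X -> \bar R) (h : {nnsfun X >-> R}) :
  (forall x, 0 <= f x) -> \int[mu]_x (h x)%:E < +oo ->
  \int[mu]_x f x + \int[mu]_x (h x)%:E <= \int[mu]_x (f x + (h x)%:E).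
Proof.
move=> f0 hoo.
have hfin : \int[mu]_x (h x)%:E \is a fin_num.
  by rewrite ge0_fin_numE// integral_ge0// => x _; rewrite lee_fin.
rewrite -leeBrDr// ge0_integralTE//.
apply: ge_ereal_sup => _ [g gf <-]; rewrite leeBrDr//.
rewrite integralT_nnsfun -sintegralD ge0_integralTE; last first.
  by move=> x; rewrite adde_ge0// lee_fin.
apply: ereal_sup_ubound; exists (add_nnsfun g h) => //= x.
by rewrite EFinD leeD2r// gf.
Qed.

Lemma sintegral_comp (phi : X -> X) (h : {nnsfun X >-> R}) :
  (forall A, measurable A -> mu (phi @^-1` A) = mu A) ->
  sintegral mu (h \o phi) = sintegral mu h.
Proof.
move=> phimu; apply: eq_fsbigr => x _; congr (_ * _).
by rewrite comp_preimage phimu.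
Qed.

(** Composition with [phi] sends simple functions below [g] to simple functions below [g \o phi]
    with the same integral, which gives one inequality. The other one is the same inequality for
    [f \o phi], since [phi] is its own inverse. *)
Lemma ge0_integral_comp_involutive (phi : X -> X) (f : X -> \bar R) :
  measurable_fun [set: X] phi -> involutive phi ->
  (forall A, measurable A -> mu (phi @^-1` A) = mu A) ->
  (forall x, 0 <= f x) ->
  \int[mu]_x f (phi x) = \int[mu]_x f x.
Proof.
move=> mphi phiK phimu f0.
suff le g : (forall x, 0 <= g x) -> \int[mu]_x g x <= \int[mu]_x g (phi x).
  apply/eqP; rewrite eq_le le// andbT.
  rewrite [leRHS](_ : _ = \int[mu]_x f (phi (phi x))); first exact: le.
  by apply: eq_integral => x _; rewrite phiK.
move=> g0; rewrite !ge0_integralTE//.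
apply: le_ereal_sup => _ [h hg <-].
have mh : measurable_fun [set: X] (h \o phi) by exact: measurableT_comp.
have fh : finite_set (range (h \o phi)).
  apply: (@sub_finite_set _ _ (range h)); last exact: fimfunP.
  by move=> _ [x _ <-]; exists (phi x).
have h0 x : (0 <= (h \o phi) x)%R by exact: fun_ge0.
pose mhM := isMeasurableFun.Build _ _ _ _ _ mh.
pose fhM := FiniteImage.Build _ _ _ fh.
pose h0M := isNonNegFun.Build _ _ _ h0.
pose h' : {nnsfun X >-> R} := HB.pack (h \o phi) mhM fhM h0M.
exists h'; first by move=> x; exact: hg.
exact: sintegral_comp.
Qed.

Lemma integral_comp_involutive (phi : X -> X) (D : set X) (f : X -> \bar R) :
  measurable_fun [set: X] phi -> involutive phi ->
  (forall A, measurable A -> mu (phi @^-1` A) = mu A) ->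
  phi @^-1` D = D ->
  \int[mu]_(x in D) f (phi x) = \int[mu]_(x in D) f x.
Proof.
move=> mphi phiK phimu phiD.
have pD x : (phi x \in D) = (x \in D).
  by rewrite -[in RHS]phiD; apply/idP/idP; rewrite !inE.
rewrite integral_mkcond integralE [RHS]integral_mkcond [RHS]integralE.
rewrite -(ge0_integral_comp_involutive (f := (f \_ D)^\+) mphi phiK phimu)//.
rewrite -(ge0_integral_comp_involutive (f := (f \_ D)^\-) mphi phiK phimu)//.
by congr (_ - _); apply: eq_integral => x _; rewrite ?funeposE ?funenegE /patch
  pD.
Qed.

End LowerIntegral.

(** * Smallness of the non-Dirac term as time tends to 0 *)

Section SmallTime.
Variable R : realType.
Local Notation leb := (@lebesgue_measure R).
Import HBNNSimple.

(** By uniqueness of Lebesgue measure it is enough to test on the intervals []a, b]]; reflection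
    turns such an interval into [[t - b, t - a[], of the same length. *)
Lemma lebesgue_measure_reflect (t : R) (A : set R) : measurable A ->
  leb ((fun s => t - s) @^-1` A) = leb A.
Proof.
move=> mA; have mphi : measurable_fun setT (fun s : R => t - s).
  by apply: measurable_funB => //; exact: measurable_cst.
apply/esym.
pose mphi_mixin := isMeasurableFun.Build _ _ (measurableTypeR R)
  (measurableTypeR R) _ mphi.
pose F : {mfun measurableTypeR R >-> measurableTypeR R} :=
  HB.pack (fun s : R => t - s) mphi_mixin.
apply: (@lebesgue_measure_unique R (pushforward leb F)) => //= _ [[a b]] _ <-.
rewrite /pushforward (_ : _ @^-1` _ = `[t - b, t - a[%classic); last first.
  by apply/seteqP; split => x /=; rewrite !in_itv/=; lra.
by rewrite !lebesgue_measure_itv/= !lte_fin ltrD2l ltrN2;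
  congr (if _ then _ else _);
  rewrite -!EFinB; congr EFin; ring.
Qed.

Local Open Scope ereal_scope.

(** Absolute continuity at 0 for lower integrals. If the integral over some []0, a[] is finite, a
    simple [h] below [f] captures it up to [e / 2]. As [h] is bounded by some [M], erasing it on
    []0, t[] costs at most [M * t]; what remains of [h], added to the integral of [f] over []0, t[],
    still fits under the integral over []0, a[]. *)
Lemma lower_integral_near0 (f : R -> \bar R) : (forall s, 0 <= f s) ->
  (forall t : R, (0 < t)%R -> \int[leb]_(s in `]0%R, t[) f s = +oo) \/
  (forall e : R, (0 < e)%R -> exists2 a : R, (0 < a)%R &
     forall t : R, (0 < t < a)%R -> \int[leb]_(s in `]0%R, t[) f s <= e%:E).
Proof.
move=> f0; have [?|] := pselect (forall t : R, (0 < t)%R ->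
  \int[leb]_(s in `]0%R, t[) f s = +oo); first by left.
move=> /existsNP[a /not_implyP[a0 /eqP Ja]]; right => e e0.
have Jge0 t : 0 <= \int[leb]_(s in `]0%R, t[) f s by exact: integral_ge0.
have {Ja}Jfin : \int[leb]_(s in `]0%R, a[) f s \is a fin_num.
  by rewrite ge0_fin_numE// ltey.
have fD0 (D : set R) x : 0 <= (f \_ D) x by rewrite /patch; case: ifP.
have e20 : (0 < e / 2)%R by rewrite divr_gt0.
have [h [hf Jh]] : exists h : {nnsfun measurableTypeR R >-> R},
    (forall x, (h x)%:E <= (f \_ `]0%R, a[%classic) x) /\
    \int[leb]_(s in `]0%R, a[) f s - (e / 2)%:E < sintegral leb h.
  have : \int[leb]_(s in `]0%R, a[) f s - (e / 2)%:E < \int[leb]_(s in `]0%R,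
    a[) f s.
    by rewrite lteBlDr// lteDl// lte_fin.
  rewrite {2}integral_mkcond ge0_integralTE// => /ereal_sup_gt[_ [h hf <-] ?].
  by exists h.
have hD x : (0 <= h x)%R by exact: fun_ge0.
have hle : \int[leb]_x (h x)%:E <= \int[leb]_(s in `]0%R, a[) f s.
  by rewrite [leRHS]integral_mkcond; apply: le_ge0_integral => // x;
    rewrite lee_fin.
have [M [M0 hM]] : exists M : R, (0 < M)%R /\ forall x, (h x <= M)%R.
  have [M0 [_ hM0]] := simple_bounded h.
  exists (`|M0| + 1)%R; split=> [|x]; first by rewrite ltr_wpDl.
  apply: le_trans (ler_norm _) (hM0 _ _ x _) => //.
  by rewrite (le_lt_trans (ler_norm _))// ltrDl.
(* This radius makes [M * t < e / 2], the second half of the error budget. *)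
exists (Num.min a (e / 2 / M))%R => [|t /andP[t0]].
  by rewrite lt_min a0/= !divr_gt0.
rewrite lt_min => /andP[ta tM].
have mI : measurable (~` `]0%R, t[%classic : set (measurableTypeR R)) by exact:
  measurableC.
(* [g] is [h] erased on []0, t[], so its support is disjoint from the interval on which [f] is to be
   estimated. *)
pose g : {nnsfun measurableTypeR R >-> R} := mul_nnsfun h (indic_nnsfun R mI).
have gE x : g x = if x \in `]0%R, t[%classic then 0%R else h x.
  have -> : g x = (h x * \1_(~` `]0%R, t[%classic) x)%R by [].
  rewrite indicE in_setC; case: ifP => _ /=; first by rewrite mulr0.
  by rewrite mulr1.
have g0 x : (0 <= g x)%R by exact: fun_ge0.
have gh x : (g x <= h x)%R by rewrite gE; case: ifP.
have goo : \int[leb]_x (g x)%:E < +oo.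
  apply: (@le_lt_trans _ _ (\int[leb]_x (h x)%:E)).
    by apply: le_ge0_integral => x; rewrite lee_fin.
  by rewrite (le_lt_trans hle)// ltey_eq Jfin.
have gfin : \int[leb]_x (g x)%:E \is a fin_num.
  by rewrite ge0_fin_numE// integral_ge0// => x _; rewrite lee_fin.
have Jg : \int[leb]_(s in `]0%R, t[) f s + \int[leb]_x (g x)%:E <=
    \int[leb]_(s in `]0%R, a[) f s.
  rewrite integral_mkcond [leRHS]integral_mkcond.
  apply: le_trans (integralD_nnsfun_le _ _) _ => //.
  apply: le_ge0_integral => x; first by rewrite adde_ge0// lee_fin.
  rewrite gE {1}/patch; case: ifPn => [|_]; last by rewrite add0e.
  rewrite inE/= adde0 /patch => /[!in_itv]/= /andP[x0 xt].
  by rewrite ifT// inE/= in_itv/= x0 (lt_trans xt).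
have tE : leb `]0%R, t[%classic = t%:E.
  by rewrite lebesgue_measure_itv/= lte_fin t0 oppr0 adde0.
have hg : \int[leb]_x (h x)%:E <= \int[leb]_x (g x)%:E + (M * t)%:E.
  have -> : (M * t)%:E = \int[leb]_x (M * \1_(`]0%R, t[%classic) x)%:E.
    transitivity (\int[leb]_x (M%:E * (\1_(`]0%R, t[%classic) x)%:E));
      last first.
      by apply: eq_integral => x _; rewrite EFinM.
    rewrite ge0_integralZl_EFin//; last 2 first.
    - by apply/measurable_EFinP; exact: measurable_indic.
    - exact: ltW.
    rewrite integral_indic// setIT EFinM; congr (_ * _); exact: esym tE.
  rewrite -ge0_integralD//; last 4 first.
  - by move=> x _; rewrite lee_fin.
  - exact/measurable_EFinP.
  - by move=> x _; rewrite lee_fin mulr_ge0// ltW.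
  - by apply/measurable_EFinP; exact: measurable_funM.
  apply: le_ge0_integral => x; rewrite -?EFinD lee_fin// gE indicE.
  by case: ifPn => _ /=; rewrite ?mulr1 ?mulr0 ?add0r ?addr0.
have {}hg : \int[leb]_(s in `]0%R, a[) f s - (e / 2)%:E <=
    \int[leb]_x (g x)%:E + (M * t)%:E.
  by rewrite (le_trans _ hg)// integralT_nnsfun ltW.
have /fineK JaE := Jfin; have /fineK gEE := gfin.
have Jtfin : \int[leb]_(s in `]0%R, t[) f s \is a fin_num.
  rewrite ge0_fin_numE//; apply: (@le_lt_trans _ _ (\int[leb]_(s in `]0%R, a[)
    f s)).
    by apply: le_trans Jg; rewrite leeDl// integral_ge0// => x _;
      rewrite lee_fin.
  by rewrite ltey_eq Jfin.
have /fineK JtE := Jtfin.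
move: hg Jg; rewrite -JaE -gEE -JtE -!EFinD -?EFinB !lee_fin.
have : (M * t < e / 2)%R by rewrite mulrC -ltr_pdivlMr.
lra.
Qed.

(* If the positive or the negative part of [k] has infinite integral near 0, the
   extended integral is infinite and [fine] sends it to 0. *)
Lemma Rintegral_reflect_near0 (k : R -> R) (e : R) : (0 < e)%R ->
  exists2 a : R, (0 < a)%R & forall t : R, (0 < t < a)%R ->
    (`| \int[leb]_(s in `]0%R, t[) k (t - s) | <= e)%R.
Proof.
move=> e0.
have reflectE (t : R) : (\int[leb]_(s in `]0%R, t[) k (t - s))%R =
    fine (\int[leb]_(s in `]0%R, t[) ((EFin \o k)^\+ s) -
          \int[leb]_(s in `]0%R, t[) ((EFin \o k)^\- s)).
  rewrite -integralE; congr fine.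
  rewrite (@integral_comp_involutive _ _ R leb (fun s =>
    t - s)%R _ (EFin \o k))//.
  - by apply: measurable_funB => //; exact: measurable_cst.
  - by move=> s /=; rewrite subKr.
  - by move=> A mA; exact: lebesgue_measure_reflect.
  - by apply/seteqP; split => s /=; rewrite !in_itv/=; lra.
have [Jp|Jp] := @lower_integral_near0 (EFin \o k)^\+ (fun=> funepos_ge0 _ _).
  exists 1%R => // t /andP[t0 _]; rewrite reflectE Jp//.
  by case: (integral _ _ _) => [r||] /=; rewrite normr0 ltW.
have [Jn|Jn] := @lower_integral_near0 (EFin \o k)^\- (fun=> funeneg_ge0 _ _).
  exists 1%R => // t /andP[t0 _]; rewrite reflectE Jn//.
  by case: (integral _ _ _) => [r||] /=; rewrite normr0 ltW.
have [a a0 Ja] := Jp _ e0; have [b b0 Jb] := Jn _ e0.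
exists (Num.min a b)%R => [|t /andP[t0]]; first by rewrite lt_min a0.
rewrite lt_min => /andP[ta tb]; rewrite reflectE.
have {Ja Jp}: \int[leb]_(s in `]0%R, t[) ((EFin \o k)^\+ s) <= e%:E.
  by apply: Ja; rewrite t0.
have {Jb Jn}: \int[leb]_(s in `]0%R, t[) ((EFin \o k)^\- s) <= e%:E.
  by apply: Jb; rewrite t0.
have : 0 <= \int[leb]_(s in `]0%R, t[) ((EFin \o k)^\+ s) by exact:
  integral_ge0.
have : 0 <= \int[leb]_(s in `]0%R, t[) ((EFin \o k)^\- s) by exact:
  integral_ge0.
case: (integral _ _ _) => [q||] //; case: (integral _ _ _) => [p||] //=.
by rewrite !lee_fin ler_norml; lra.
Qed.
End SmallTime.

(** * Cubes, and positivity of the measure of the unit sphere *)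

Section LebesgueTuple.
Variable R : realType.

(** Half-open sides make consecutive dyadic cubes disjoint. *)
Definition cube m (a b : R) : set (m.-tuple R) :=
  [set x | forall i, a <= tnth x i < b].

Lemma measurable_cube m (a b : R) : measurable (@cube m a b).
Proof.
rewrite (_ : cube a b = \bigcap_(i in [set: 'I_m])
    ((fun x : m.-tuple R => tnth x i) @^-1` `[a, b[%classic)); last first.
  by apply/seteqP; split => x /= h i; [move=> _|]; move: (h i);
    rewrite /= in_itv/=; apply.
apply: fin_bigcap_measurable => [|i _]; first exact: finite_finset.
by rewrite -[X in measurable X]setTI; exact: measurable_tnth.
Qed.

Lemma cube_snoc m (a b : R) :
  @snoc R m @^-1` cube a b = cube a b `*` `[a, b[%classic.
Proof.
apply/seteqP; split => -[x s] /=.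
  move=> h; split => [i|/=].
    move: (h (widen_ord (leqnSn m) i)).
    by rewrite !(tnth_nth 0)/= nth_rcons size_tuple ltn_ord.
  by move: (h ord_max); rewrite (tnth_nth 0)/= nth_rcons size_tuple ltnn eqxx
    in_itv.
move=> [/= h]; rewrite in_itv/= => sab i.
rewrite (tnth_nth 0)/= nth_rcons size_tuple.
case: ltnP => im; first by move: (h (Ordinal im)); rewrite (tnth_nth 0).
by rewrite ifT// eqn_leq im -ltnS ltn_ord.
Qed.

Lemma lebesgueT_cube m (a b : R) : a <= b ->
  lebesgueT m (cube a b) = ((b - a) ^+ m)%:E.
Proof.
move=> ab; elim: m => [|m IH].
  rewrite expr0 /= diracE mem_set//= => i; by case: i.
transitivity ((lebesgueT m \x @lebesgue_measure R)%E (cube a b `*` `[a,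
  b[%classic)).
  by rewrite -cube_snoc.
transitivity (lebesgueT m (cube a b) * @lebesgue_measure R `[a, b[%classic)%E.
  by apply: product_measure1E => //; exact: measurable_cube.
have -> : @lebesgue_measure R `[a, b[%classic = (b - a)%:E.
  rewrite lebesgue_measure_itv/= lte_fin.
  move: ab; rewrite le_eqVlt => /predU1P[->|->]; last by rewrite EFinB.
  by rewrite ltxx subrr.
by rewrite exprSr EFinM -IH.
Qed.

Lemma measurable_enorm m : measurable_fun [set: m.-tuple R] (@enorm R m).
Proof.
apply: (@measurableT_comp _ _ _ _ _ _ (@Num.sqrt R)).
  by apply: continuous_measurable_fun; exact: sqrt_continuous.
apply: measurable_sum => i.
by apply: measurable_funX; exact: measurable_tnth.
Qed.

Lemma coord_le_enorm m (x : m.-tuple R) i : `|tnth x i| <= enorm x.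
Proof.
rewrite /enorm -sqrtr_sqr ler_wsqrtr// (bigD1 i)//= lerDl sumr_ge0// => j _.
exact: sqr_ge0.
Qed.

(** Since [omega] is a [fine], both 0 and [+oo] have to be excluded. The cone over the sphere is the
    punctured closed unit ball, which is squeezed between two cubes of positive finite volume. *)
Lemma omega_gt0 n : (0 < n)%N -> 0 < omega R n.
Proof.
move=> n0; have nR0 : 0 < n%:R^-1 :> R by rewrite invr_gt0 ltr0n.
rewrite /omega /sphere_measure.
set A := [set x | _].
have enormZ (r : R) (y : n.-tuple R) : 0 <= r ->
    enorm [tuple r * tnth y i | i < n] = r * enorm y.
  move=> r0; rewrite /enorm -{2}(ger0_norm r0) -(sqrtr_sqr r).
  rewrite -sqrtrM ?sqr_ge0// mulr_sumr; congr Num.sqrt.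
  by apply: eq_bigr => i _; rewrite tnth_mktuple exprMn.
have AE : A = (@enorm R n) @^-1` `]0, 1]%classic.
  apply/seteqP; split => x /=; rewrite in_itv/=.
    by move=> [r [y y1 [r01 ->]]]; rewrite enormZ ?y1 ?mulr1// ltW//;
      case/andP: r01.
  move=> /andP[x0 x1]; exists (enorm x).
  exists [tuple (enorm x)^-1 * tnth x i | i < n].
    by rewrite /= enormZ ?invr_ge0 ?ltW// mulVf// gt_eqF.
  split; first by rewrite x0.
  by apply: eq_from_tnth => i; rewrite !tnth_mktuple mulVKf// gt_eqF.
have mA : measurable A.
  by rewrite AE -[X in measurable X]setTI; exact: measurable_enorm.
(* Coordinates lie in [[-1, 1]]; the upper end exceeds 1 because cubes are half-open. *)
have Aub : A `<=` cube (-1) 2.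
  rewrite AE => x /=; rewrite in_itv/= => /andP[_ x1] i.
  have := le_trans (coord_le_enorm x i) x1; rewrite ler_norml; lra.
(* Here each of the [n] squared coordinates is at most [1 / n], so the norm is at most 1, and the
   positive lower end keeps the origin out. *)
have Alb : cube (n%:R^-1 / 2) n%:R^-1 `<=` A.
  rewrite AE => x h /=; rewrite in_itv/=; apply/andP; split.
    rewrite (lt_le_trans _ (coord_le_enorm x (Ordinal n0)))//
      normr_gt0 gt_eqF//.
    by have /andP[+ _] := h (Ordinal n0); apply: lt_le_trans; rewrite divr_gt0.
  rewrite -[leRHS]sqrtr1 /enorm ler_sqrt//.
  apply: (@le_trans _ _ (\sum_(i < n) n%:R^-1)).
    apply: ler_sum => i _; have /andP[h1 h2] := h i.
    have x0 : 0 <= tnth x i by rewrite (le_trans _ h1)// divr_ge0.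
    rewrite (@le_trans _ _ (n%:R^-1 ^+ 2))//.
      by rewrite lerXn2r// ?nnegrE// ltW.
    by rewrite expr2 ger_pMr// invf_le1 ?ltr0n// ler1n.
  by rewrite sumr_const card_ord -(mulr_natr n%:R^-1) mulVf// pnatr_eq0 -lt0n.
have nV2 : n%:R^-1 / 2 < n%:R^-1 :> R by lra.
have fineA : lebesgueT n A \is a fin_num.
  rewrite ge0_fin_numE//; apply: le_lt_trans (ltry (3 ^+ n)).
  have -> : 3 ^+ n = (2 - - 1) ^+ n :> R by congr (_ ^+ _); lra.
  rewrite -lebesgueT_cube; last by lra.
  by apply: le_measure => //; rewrite inE//; exact: measurable_cube.
rewrite -(fineK fineA)/= mulr_gt0 ?ltr0n// fine_gt0//.
rewrite -ge0_fin_numE// fineA andbT.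
apply: (@lt_le_trans _ _ (lebesgueT n (cube (n%:R^-1 / 2) n%:R^-1))).
  by rewrite lebesgueT_cube ?ltW// lte_fin exprn_gt0// subr_gt0.
by apply: le_measure => //; rewrite inE//; exact: measurable_cube.
Qed.

End LebesgueTuple.

(** * The gradient of the fundamental solution *)

Section Gradient.
Variable R : realType.

(** The left side is what the chain rule yields for a derivative of [Esol], with [r] the norm and
    [a] the coordinate. The exponent [n - 2] cancels against the normalising constant. *)
Lemma radial_power_rule n (w r a : R) : (3 <= n)%N -> 0 < w -> 0 < r ->
  - (1 / ((n%:R - 2) * w)) *
    (- (r ^+ (n - 2)) ^- 2 * ((n - 2)%:R * r ^+ (n - 2).-1 * (a / r))) =
  a / (w * r ^+ n).
Proof.
(* Writing [n] as [k + 3] makes the truncated difference [n - 2] agree with the real one. *)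
case: n => [|[|[|k]]]// _ w0 r0.
rewrite !subSS subn0/=; have -> : k.+3%:R - 2 = k.+1%:R :> R.
  by rewrite -[k.+3]addn2 natrD addrK.
have rk0 : 0 < r ^+ k by rewrite exprn_gt0.
have k0 : 0 < k.+1%:R :> R by rewrite ltr0n.
rewrite (exprS r k.+2) (exprS r k.+1) (exprS r k).
move: (r ^+ k) (k.+1%:R) rk0 k0 => p q p0 q0.
by field; rewrite !gt_eqF.
Qed.

Lemma partial_Esol n (i : 'I_n) (x : n.-tuple R) : (3 <= n)%N -> 0 < enorm x ->
  partial i (@Esol R n) x = tnth x i / (omega R n * enorm x ^+ n).
Proof.
move=> n3 x0; have w0 : 0 < omega R n by rewrite omega_gt0// (leq_trans _ n3).
(* Along the [i]-th coordinate line the norm is [sqrt (s ^+ 2 + B)] with [B] constant, so a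
   one-variable chain rule applies. *)
pose B := \sum_(j < n | j != i) tnth x j ^+ 2.
have xE : \sum_(j < n) tnth x j ^+ 2 = tnth x i ^+ 2 + B by rewrite (bigD1 i).
have sE s : enorm (set_coord x i s) = Num.sqrt (s ^+ 2 + B).
  rewrite /enorm (bigD1 i)//= tnth_mktuple eqxx; congr (Num.sqrt (_ + _)).
  by apply: eq_bigr => j /negPf ji; rewrite tnth_mktuple ji.
have q0 : 0 < tnth x i ^+ 2 + B by move: x0; rewrite /enorm xE sqrtr_gt0.
have nE : enorm x = Num.sqrt (tnth x i ^+ 2 + B) by rewrite /enorm xE.
rewrite /partial /Esol; under eq_fun do rewrite sE.
rewrite nE; set c := 1 / _; set a := tnth x i in q0 nE *.
set r := Num.sqrt (a ^+ 2 + B).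
have r0 : 0 < r by rewrite sqrtr_gt0.
have dq : is_derive a 1 (fun s : R => s ^+ 2 + B) (2 * a).
  rewrite (_ : (fun s : R => s ^+ 2 + B) = (id ^+ 2) + cst B)//.
  by apply: is_derive_eq; rewrite addr0 scaler1/= expr1.
have dr : is_derive a 1 (fun s : R => Num.sqrt (s ^+ 2 + B)) (a / r).
  have dS := is_derive1_sqrt q0.
  apply: is_derive_eq (@is_derive1_comp R Num.sqrt (fun s =>
    s ^+ 2 + B) a _ _ dS dq) _.
  by rewrite -/r; field; rewrite gt_eqF.
have drn : is_derive a 1 (fun s : R => Num.sqrt (s ^+ 2 + B) ^+ (n - 2))
   ((n - 2)%:R * r ^+ (n - 2).-1 * (a / r)).
  have dX : is_derive r 1 (fun y : R => y ^+ (n - 2)) ((n - 2)%:R * r ^+ (n -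
    2).-1).
    by split; [exact: exprn_derivable | rewrite exp_derive scaler1].
  exact: (@is_derive1_comp R (fun y => y ^+ (n - 2)) _ a _ _ dX dr).
have dV : is_derive a 1 (fun s : R => (Num.sqrt (s ^+ 2 + B) ^+ (n - 2))^-1)
   (- (r ^+ (n - 2)) ^- 2 * ((n - 2)%:R * r ^+ (n - 2).-1 * (a / r))).
  by apply: (@is_deriveV R _ a _ 1 _ drn); rewrite gt_eqF// exprn_gt0.
have dE : is_derive a 1 (fun s : R => - c * (1 / Num.sqrt (s ^+ 2 + B) ^+ (n -
  2)))
  (- c * (- (r ^+ (n - 2)) ^- 2 * ((n - 2)%:R * r ^+ (n - 2).-1 * (a / r)))).
  under eq_fun do rewrite div1r.
  exact: is_deriveZ.
rewrite derive1E; have -> := @derive_val _ _ _ _ _ _ _ dE.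
exact: radial_power_rule.
Qed.

End Gradient.

(** * Unboundedness of the Dirac term by dyadic summation *)

Section TangentialBlowup.
Variable R : realType.

Lemma exp2V_gt0 k : 0 < 2 ^- k :> R.
Proof. by rewrite invr_gt0 exprn_gt0. Qed.

Lemma ler_exp2V k l : (k <= l)%N -> 2 ^- l <= 2 ^- k :> R.
Proof.
move=> kl; rewrite lef_pV2 ?posrE ?exprn_gt0// ler_weXn2l//.
by rewrite ler1n.
Qed.

Lemma exp2VS k : 2 * 2 ^- k.+1 = 2 ^- k :> R.
Proof. by rewrite exprS invfM mulVKf. Qed.

Lemma enorm_le m (x : m.-tuple R) (b : R) :
  (forall i, `|tnth x i| <= b) -> enorm x <= m%:R * b.
Proof.
move=> xb; case: m x xb => [|m] x xb.
  by rewrite /enorm big_ord0 sqrtr0 mul0r.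
have b0 : 0 <= b by apply: le_trans (xb ord0).
rewrite -(ger0_norm (mulr_ge0 (ler0n R m.+1) b0)) -sqrtr_sqr ler_wsqrtr//.
apply: (@le_trans _ _ (\sum_(i < m.+1) b ^+ 2)).
  by apply: ler_sum => i _; rewrite -[leLHS]real_normK ?num_real//
    lerXn2r ?nnegrE.
rewrite sumr_const card_ord exprMn -[leLHS]mulr_natl; apply: ler_wpM2r.
  exact: sqr_ge0.
by rewrite expr2 ler_peMr// ler1n.
Qed.

Lemma tnth_snoc_widen m (y : m.-tuple R) (s : R) (i : 'I_m) :
  tnth (snoc (y, s)) (widen_ord (leqnSn m) i) = tnth y i.
Proof. by rewrite !(tnth_nth 0)/= nth_rcons size_tuple ltn_ord. Qed.

Lemma tnth_snoc_max m (y : m.-tuple R) (s : R) :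
  tnth (snoc (y, s)) ord_max = s.
Proof. by rewrite (tnth_nth 0)/= nth_rcons size_tuple ltnn eqxx. Qed.

Lemma ord_widen_or_max m (j : 'I_m.+1) :
  j = ord_max \/ exists i, j = widen_ord (leqnSn m) i.
Proof.
have [jm|mj] := ltnP j m; last first.
  by left; apply/val_inj/eqP; rewrite /= eqn_leq mj -ltnS ltn_ord.
by right; exists (Ordinal jm); exact: val_inj.
Qed.

(** On the [k]-th dyadic cube the numerator is at least [2 ^- k] and the distance at most
    [3 (m + 1) 2 ^- k], so the integrand is at least [C] divided by the volume of the cube. Each of
    the [N] disjoint cubes thus contributes at least [C]. *)
Lemma tangential_integral_ge m (i : 'I_m) N (x : m.-tuple R) (s : R) :
  (2 <= m)%N -> cube 0 (2 ^- N) x -> 0 < s < 2 ^- N ->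
  N%:R * (omega R m.+1 * (3 * m.+1%:R) ^+ m.+1)^-1 <=
  \int[lebesgueT m]_y
    (partial (widen_ord (leqnSn m) i) (@Esol R m.+1) (snoc (subT x y, s)) *
     \1_(cube (-2) 0) y).
Proof.
move=> m2 xN /andP[s0 sN].
set C := (omega R m.+1 * _)^-1.
have w0 : 0 < omega R m.+1 by exact: omega_gt0.
have C0 : 0 <= C by rewrite invr_ge0 mulr_ge0 ?exprn_ge0 ?mulr_ge0// ltW.
pose z y := snoc (subT x y, s).
pose f y := partial (widen_ord (leqnSn m) i) (@Esol R m.+1) (z y) *
  \1_(cube (-2) 0) y.
have zs y : s <= enorm (z y).
  by rewrite (le_trans (ler_norm s))// -{1}(tnth_snoc_max (subT x y) s)
    coord_le_enorm.
have z0 y : 0 < enorm (z y) by exact: lt_le_trans (zs y).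
have fE y : f y = (tnth x i - tnth y i) / (omega R m.+1 * enorm (z y) ^+ m.+1) *
    \1_(cube (-2) 0) y.
  by rewrite /f partial_Esol// tnth_snoc_widen tnth_mktuple.
have fE1 y : cube (-2) 0 y ->
    f y = (tnth x i - tnth y i) / (omega R m.+1 * enorm (z y) ^+ m.+1).
  by move=> Qy; rewrite fE indicE mem_set// mulr1.
have den_gt0 y : 0 < omega R m.+1 * enorm (z y) ^+ m.+1.
  by rewrite mulr_gt0// exprn_gt0.
(* Nonnegativity on all of Q, from [tnth y i < 0 <= tnth x i], permits discarding everything outside
   the dyadic cubes. *)
have f0 y : 0 <= f y.
  have [Qy|nQy] := pselect (cube (-2) 0 y); last first.
    by rewrite fE indicE memNset// mulr0.
  rewrite fE1// divr_ge0 ?ltW//.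
  have /andP[x0 _] := xN i; have /andP[_ y0] := Qy i; lra.
pose B k : set (m.-tuple R) := cube (- (2 * 2 ^- k)) (- 2 ^- k).
have BQ k y : B k y -> cube (-2) 0 y.
  move=> By j; have /andP[h1 h2] := By j.
  have : 2 ^- k <= 2 ^- 0 :> R by exact: ler_exp2V.
  have := exp2V_gt0 k; rewrite expr0 invr1; lra.
(* The lower end [- (2 * 2 ^- l)] of [B l] is at or above the upper end [- 2 ^- k] of [B k]. *)
have Bdisj k l y : (k < l)%N -> B k y -> B l y -> False.
  move=> kl /(_ i) /andP[_ h1] /(_ i) /andP[h2 _].
  case: l kl h2 => // l kl; rewrite exp2VS => h2.
  have := ler_exp2V (kl : (k <= l)%N); lra.
have fB k y : (k < N)%N -> B k y -> C / 2 ^- k ^+ m <= f y.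
  move=> kN By; rewrite fE1; last exact: BQ By.
  have kNR := ler_exp2V (ltnW kN); have k0 := exp2V_gt0 k.
  have xy j : 2 ^- k <= tnth x j - tnth y j <= 3 * 2 ^- k.
    have /andP[h1 h2] := By j; have /andP[h3 h4] := xN j; lra.
  have zle : enorm (z y) <= m.+1%:R * (3 * 2 ^- k).
    apply: enorm_le => j; have [->|[l ->]] := ord_widen_or_max j.
      rewrite tnth_snoc_max ger0_norm ?ltW//; lra.
    rewrite tnth_snoc_widen tnth_mktuple ler_norml; have := xy l; lra.
  have -> : C / 2 ^- k ^+ m =
      2 ^- k / (omega R m.+1 * (m.+1%:R * (3 * 2 ^- k)) ^+ m.+1).
    have -> : (m.+1%:R * (3 * 2 ^- k)) ^+ m.+1 =
        (3 * m.+1%:R) ^+ m.+1 * (2 ^- k * 2 ^- k ^+ m) :> R.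
      by rewrite -exprS -exprMn; congr (_ ^+ _); ring.
    have : 0 < (3 * m.+1%:R) ^+ m.+1 :> R by rewrite exprn_gt0// mulr_gt0.
    have : 0 < 2 ^- k ^+ m :> R by rewrite exprn_gt0.
    rewrite /C.
    move: ((3 * _ : R) ^+ _) (2 ^- k ^+ m : R) (2 ^- k : R) k0 =>
      p q r r0 q0 p0.
    by field; rewrite !gt_eqF.
  apply: ler_pM.
  - exact: ltW.
  - by rewrite invr_ge0 mulr_ge0 ?exprn_ge0 ?mulr_ge0// ltW.
  - by have /andP[] := xy i.
  rewrite lef_pV2 ?posrE//; last first.
    by rewrite mulr_gt0// exprn_gt0// !mulr_gt0.
  by rewrite ler_pM2l// lerXn2r ?nnegrE ?mulr_ge0// ltW.
have f_lower y : \sum_(k < N) C / 2 ^- k ^+ m * \1_(B k) y <= f y.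
  have [[k Bk]|nB] := pselect (exists k : 'I_N, B k y).
    rewrite (bigD1 k)//= big1 ?addr0 => [|l lk].
      by rewrite indicE mem_set// mulr1 fB.
    rewrite indicE memNset ?mulr0// => Bl.
    move: lk; rewrite -val_eqE/= neq_ltn => /orP[lk|kl].
      exact: Bdisj lk Bl Bk.
    exact: Bdisj kl Bk Bl.
  rewrite big1// => k _; rewrite indicE memNset ?mulr0// => Bk.
  by apply: nB; exists k.
(* The numerator is at most [1 + 2] and the distance at least [s]. This bound makes the integral
   finite; otherwise [fine] would turn an infinite value into 0 and the lower bound would be
   lost. *)
pose M : R := 3 / (omega R m.+1 * s ^+ m.+1).
have M0 : 0 <= M by rewrite divr_ge0// mulr_ge0 ?exprn_ge0// ltW.
have f_upper y : f y <= M * \1_(cube (-2) 0) y.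
  have [Qy|nQy] := pselect (cube (-2) 0 y); last first.
    by rewrite fE indicE memNset// !mulr0.
  rewrite fE1// indicE mem_set// mulr1 ler_pM//.
  - have /andP[x0 _] := xN i; have /andP[_ y0] := Qy i; lra.
  - by rewrite invr_ge0 ltW.
  - have /andP[_ x0] := xN i; have /andP[y0 _] := Qy i.
    have : 2 ^- N <= 2 ^- 0 :> R by exact: ler_exp2V.
    rewrite expr0 invr1; lra.
  rewrite lef_pV2 ?posrE ?mulr_gt0 ?exprn_gt0// ler_pM2l// lerXn2r ?nnegrE//
    ltW//.
have fint : (\int[lebesgueT m]_y (f y)%:E < +oo)%E.
  apply: (@le_lt_trans _ _ (\int[lebesgueT m]_y (M * \1_(cube (-2) 0) y)%:E)%E).
    by apply: le_ge0_integral => y; rewrite lee_fin.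
  rewrite (eq_integral (fun y => M%:E * (\1_(cube (-2) 0) y)%:E)%E) => [|y _//].
  rewrite ge0_integralZl_EFin//; last first.
    by apply/measurable_EFinP/measurable_indic; exact: measurable_cube.
  rewrite integral_indic ?setIT; last 2 first.
  - by [].
  - exact: measurable_cube.
  rewrite (_ : (_ * _)%E = (M * (0 - - 2) ^+ m)%:E) ?ltry// [RHS]EFinM.
  by congr (_ * _)%E; apply: lebesgueT_cube; lra.
have ffin : (\int[lebesgueT m]_y (f y)%:E \is a fin_num)%E.
  by rewrite ge0_fin_numE// integral_ge0// => y _; rewrite lee_fin.
rewrite /Rintegral -lee_fin fineK//.
apply: (@le_trans _ _ (\int[lebesgueT m]_y
    (\sum_(k < N) C / 2 ^- k ^+ m * \1_(B k) y)%:E)%E); last first.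
  apply: le_ge0_integral => y; rewrite lee_fin//.
  by apply: sumr_ge0 => k _; rewrite mulr_ge0// divr_ge0// exprn_ge0// ltW//
    exp2V_gt0.
have mB k : measurable (B k) by exact: measurable_cube.
under eq_integral do rewrite -sumEFin.
rewrite ge0_integral_sum//; last 2 first.
- move=> k; apply/measurable_EFinP.
  by apply: measurable_funM => //; exact: measurable_indic.
- by move=> k y _; rewrite lee_fin mulr_ge0// divr_ge0// exprn_ge0// ltW//
    exp2V_gt0.
rewrite (eq_bigr (fun=> C%:E)) => [|k _].
  by rewrite sumEFin sumr_const card_ord mulr_natl.
rewrite (eq_integral (fun y => (C / 2 ^- k ^+ m)%:E * (\1_(B k) y)%:E)%E) =>
  [|y _//].
have k0 := exp2V_gt0 k.
rewrite ge0_integralZl_EFin//; last 2 first.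
- by apply/measurable_EFinP/measurable_indic.
- by rewrite divr_ge0// exprn_ge0// ltW.
rewrite integral_indic ?setIT// -[in RHS](divfK (_ : 2 ^- k ^+ m != 0) C);
  last first.
  by rewrite expf_neq0// gt_eqF.
rewrite [RHS]EFinM; congr (_ * _)%E.
rewrite [in RHS](_ : 2 ^- k = - 2 ^- k - - (2 * 2 ^- k)); last by lra.
by apply: lebesgueT_cube; lra.
Qed.

End TangentialBlowup.

(** * Essential bounds and null sets *)

Section AlmostEverywhere.
Variable R : realType.

Lemma Lfun_indic d (X : measurableType d) (mu : {measure set X -> \bar R})
    (A : set X) (p : R) : measurable A -> (mu A < +oo)%E -> 1 <= p ->
  (\1_A : X -> R) \in Lfun mu p%:E.
Proof.
move=> mA Aoo p1; have p0 : 0 < p by exact: lt_le_trans p1.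
apply/andP; split; rewrite inE/=; first exact: measurable_indic.
rewrite /finite_norm unlock; apply: poweR_lty.
rewrite (eq_integral (fun x => (\1_A x)%:E)) => [|x _].
  by rewrite integral_indic// setIT.
rewrite /= indicE; case: (x \in A); rewrite ?normr1 ?normr0 ?powR1//.
by rewrite powR0// gt_eqF.
Qed.

Lemma Lfun_infty_indic d (X : measurableType d) (mu : {measure set X -> \bar R})
    (A : set X) : measurable A -> (\1_A : X -> R) \in Lfun mu +oo%E.
Proof.
move=> mA; apply/andP; split; rewrite inE/=; first exact: measurable_indic.
rewrite /finite_norm unlock; case: ifP => _; last exact: ltry.
apply: le_lt_trans (ltry 1); apply/ess_supP/aeW => x /=.
by rewrite lee_fin indicE; case: (x \in A); rewrite ?normr1 ?normr0.
Qed.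

Lemma in_Lp_infty_bounded d (X : measurableType d)
    (mu : {measure set X -> \bar R}) (D : set X) (f : X -> R) :
  in_Lp mu D +oo%E f -> exists M, {ae mu, forall x, D x -> `|f x| <= M}.
Proof.
move=> /andP[_]; rewrite inE/= /finite_norm unlock; case: ifPn => [_|muX].
  move=> foo; have [M fM] : exists M : R,
      (ess_sup mu (abse \o (EFin \o patch (fun=> 0%R) D f)) <= M%:E)%E.
    by case: (ess_sup _ _) foo => [r _||_]//; [exists r|
      exists 0; rewrite leNye].
  exists M; move/ess_supP : fM; apply: filterS => x /=.
  by rewrite lee_fin /patch => + Dx; rewrite mem_set.
(* If the whole space is null, the norm carries no information, but every property holds almost
   everywhere. *)
move=> _; exists 0, setT; split => //.
by apply/eqP; rewrite eq_le measure_ge0 andbT leNgt.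
Qed.

Lemma ae_exists d (X : measurableType d) (mu : {measure set X -> \bar R})
    (G : set X) (P : X -> Prop) : measurable G -> (0 < mu G)%E ->
  {ae mu, forall x, P x} -> exists2 x, G x & P x.
Proof.
move=> mG muG aeP; apply: contrapT => nP.
have : mu.-negligible G.
  by apply: negligibleS aeP => x Gx /= Px; apply: nP; exists x.
by move/negligibleP => /(_ mG) G0; rewrite G0 ltxx in muG.
Qed.

(** The product measure of a set is the integral of the measures of its sections, so almost every
    section of a null set is null. This allows the space point to be fixed before the time is
    chosen. *)
Lemma ae_xsection d1 d2 (X : measurableType d1) (Y : measurableType d2)
    (mu : {measure set X -> \bar R})
    (nu : {sigma_finite_measure set Y -> \bar R}) (P : X * Y -> Prop) :
  {ae (mu \x nu)%E, forall z, P z} ->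
  {ae mu, forall x, {ae nu, forall y, P (x, y)}}.
Proof.
move=> [Z [mZ Z0 PZ]].
have : ae_eq mu setT (nu \o xsection Z) (cst 0%E).
  apply/ae_eq_integral_abs => //; first exact: measurable_fun_xsection.
  by rewrite -[RHS]Z0; apply: eq_integral => x _; rewrite gee0_abs.
apply: filterS => x /(_ I) /= Zx0; exists (xsection Z x); split => //.
  exact: measurable_xsection.
by move=> y /= nPxy; rewrite /xsection/= inE; apply: PZ.
Qed.

End AlmostEverywhere.

(** * The boundary datum and its velocity *)

Section NormalDatum.
Variables (R : realType) (m : nat).
Implicit Types (x : m.-tuple R) (s t : R).

Definition normal_datum (j : 'I_m.+1) (z : m.-tuple R * R) : R :=
  (j == ord_max)%:R * (\1_(cube (-2) 0) z.1 * \1_`]0, 1[%classic z.2).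

(** Only times in []0, 1[] are sampled, where the time cutoff equals 1, and only the normal
    component of the datum is nonzero. *)
Lemma velocity_normal_datum (i : 'I_m.+1) x s t : 0 < t < 1 ->
  velocity normal_datum i ((x, s), t) =
  \int[lebesgue_measure]_(r in `]0, t[) \int[lebesgueT m]_y
      (Kreg i ord_max (snoc (subT x y, s)) (t - r) * \1_(cube (-2) 0) y) +
  \int[lebesgueT m]_y
      (partial i (@Esol R m.+1) (snoc (subT x y, s)) * \1_(cube (-2) 0) y).
Proof.
move=> /andP[t0 t1].
have normE y r : 0 < r < 1 -> normal_datum ord_max (y, r) = \1_(cube (-2) 0) y.
  move=> r01; rewrite /normal_datum eqxx mul1r/= !indicE.
  by rewrite (mem_set (_ : `]0, 1[%classic r)) ?mulr1//= in_itv.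
rewrite /velocity (bigD1 ord_max)//= big1 ?addr0 => [|j /negPf jmax].
  rewrite eqxx mul1r; congr (_ + _).
    apply: eq_Rintegral => r; rewrite inE/= in_itv/= => /andP[r0 rt].
    by apply: eq_Rintegral => y _; rewrite normE// r0 (lt_trans rt).
  by apply: eq_Rintegral => y _; rewrite normE// t0.
rewrite jmax mul0r addr0.
have tang0 y r : normal_datum j (y, r) = 0 by rewrite /normal_datum jmax mul0r.
rewrite [LHS](_ : _ = \int[lebesgue_measure]_(r in `]0, t[) 0).
  by rewrite /Rintegral integral0.
apply: eq_Rintegral => r _; rewrite -[RHS](_ : \int[lebesgueT m]_y 0 = 0).
  by apply: eq_Rintegral => y _; rewrite tang0 mulr0.
by rewrite /Rintegral integral0.
Qed.

(** [tau] stands for the minimum of 1 and [T], a real number even when [T] is infinite. The datum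
    extended by 0 is then the indicator of a set of finite measure. *)
Lemma normal_datum_indic (T : \bar R) (tau : R) (j : 'I_m.+1) :
  (forall t, (0 < t < 1 /\ (t%:E < T)%E) <-> 0 < t < tau) ->
  patch (fun=> 0) (boundary_cyl T) (normal_datum j) =
  \1_(if j == ord_max then cube (-2) 0 `*` `]0, tau[%classic else set0).
Proof.
move=> tauP; apply/funext => -[y t]; rewrite /patch /normal_datum.
case: (j == ord_max); last by rewrite mul0r if_same indic0.
rewrite mul1r !indicE /=; have -> : ((y, t) \in cube (-2) 0 `*` `]0,
  tau[%classic) =
    [&& (y, t) \in boundary_cyl T, y \in cube (-2) 0 & t \in `]0, 1[%classic].
  apply/idP/and3P; rewrite !inE /boundary_cyl /= !in_itv/=.
    by move=> [Qy /tauP[/andP[t0 t1] tT]]; rewrite t0 t1.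
  by move=> [[t0 tT] Qy /andP[_ t1]]; split => //; apply/tauP; rewrite t0 t1.
by case: (_ \in boundary_cyl T); case: (y \in _); case: (t \in _);
  rewrite ?mulr1 ?mulr0.
Qed.

Lemma normal_datum_Lp (T : \bar R) (p : R) (tau : R) (j : 'I_m.+1) :
  0 < tau -> (forall t, (0 < t < 1 /\ (t%:E < T)%E) <-> 0 < t < tau) -> 1 <= p
    ->
  in_Lp (lebesgueT m \x @lebesgue_measure R)%E (boundary_cyl T) p%:E
    (normal_datum j) /\
  in_Lp (lebesgueT m \x @lebesgue_measure R)%E (boundary_cyl T) +oo%E
    (normal_datum j).
Proof.
move=> tau0 tauP p1; rewrite /in_Lp (normal_datum_indic _ tauP).
have mA : measurable (cube (-2) 0 `*` `]0, tau[%classic : set (m.-tuple R * R)).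
  by apply: measurableX => //; exact: measurable_cube.
have mA' : measurable (if j == ord_max then cube (-2) 0 `*` `]0, tau[%classic
    else set0 : set (m.-tuple R * R)) by case: ifP.
split; [apply: Lfun_indic => //|exact: Lfun_infty_indic].
case: ifP => _; last by rewrite measure0.
apply: (@le_lt_trans _ _ (lebesgueT m (cube (-2) 0) *
    @lebesgue_measure R `]0%R, tau[%classic)%E).
  rewrite le_eqVlt; apply/orP; left; apply/eqP.
  by apply: product_measure1E => //; exact: measurable_cube.
by rewrite lebesgueT_cube// lebesgue_measure_itv/= lte_fin tau0 oppr0 adde0
  -EFinM ltry.
Qed.

End NormalDatum.

(** * Contradiction with an essential bound *)

Theorem theorem1p2 (R : realType) (n : nat) (T : \bar R) (p : R)
    (hn : (3 <= n)%N) (hT : (0 < T)%E) (hp : 1 <= p) :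
  exists g : 'I_n.-1.+1 -> n.-1.-tuple R * R -> R,
    (forall j,
       in_Lp (lebesgueT n.-1 \x @lebesgue_measure R)%E
         (boundary_cyl T) p%:E (g j) /\
       in_Lp (lebesgueT n.-1 \x @lebesgue_measure R)%E
         (boundary_cyl T) +oo%E (g j)) /\
    ~ (forall i,
       in_Lp ((lebesgueT n.-1 \x @lebesgue_measure R) \x @lebesgue_measure R)%E
         (halfspace_cyl T) +oo%E (velocity g i)).
Proof.
have m2 : (2 <= n.-1)%N by case: n hn.
move: (n.-1) m2 => m m2.
have [tau [tau0 tauP]] : exists tau : R, 0 < tau /\
    forall t, (0 < t < 1 /\ (t%:E < T)%E) <-> 0 < t < tau.
  case: T hT => [r| |]// r0.
    exists (Num.min 1 r); split; first by rewrite lt_min ltr01 -lte_fin r0.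
    move=> t; rewrite lt_min lte_fin; split.
      by move=> [/andP[-> ->] ->].
    by move=> /and3P[-> -> ->].
  by exists 1; split => // t; rewrite ltry; split => [[]|].
exists (@normal_datum R m); split=> [j|]; first exact: normal_datum_Lp tauP hp.
(* The first coordinate, which is tangential. *)
pose i : 'I_m := Ordinal (ltnW m2).
move=> /(_ (widen_ord (leqnSn m) i))/in_Lp_infty_bounded[M VM].
pose C := (omega R m.+1 * (3 * m.+1%:R) ^+ m.+1)^-1.
have C0 : 0 < C by rewrite invr_gt0 mulr_gt0 ?omega_gt0// exprn_gt0// mulr_gt0.
(* Enough dyadic scales for the Dirac term to exceed [M + 1], leaving room 1 for the other term. *)
pose N := Num.bound ((`|M| + 1) / C).
have MN : M + 1 < N%:R * C.
  have : (`|M| + 1) / C < N%:R by apply: archi_boundP;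
    rewrite divr_ge0 ?addr_ge0// ltW.
  by rewrite ltr_pdivrMr//; apply: le_lt_trans; have := ler_norm M; lra.
pose G : set (m.-tuple R * measurableTypeR R) := cube 0 (2 ^- N) `*` `]0, 2 ^-
  N[%classic.
have mG : measurable G by apply: measurableX => //; exact: measurable_cube.
have N0 := exp2V_gt0 R N.
(* A point of the small cube at which the bound holds for almost every time. Fixing it now is
   essential, because the time scale [a] below depends on it. *)
have [|[x s] [/= Gx]] := ae_exists mG _ (ae_xsection VM).
  apply: (@lt_le_trans _ _ (lebesgueT m (cube 0 (2 ^- N)) *
    @lebesgue_measure R `]0%R, 2 ^- N[%classic)%E).
    rewrite lebesgueT_cube ?ltW// lebesgue_measure_itv/= lte_fin N0.
    by rewrite oppr0 adde0 addr0 -EFinM lte_fin mulr_gt0 ?exprn_gt0.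
  rewrite le_eqVlt; apply/orP; left; apply/eqP/esym.
  by apply: product_measure1E => //; exact: measurable_cube.
rewrite in_itv/= => /andP[s0 sN] Vxs.
pose k r := \int[lebesgueT m]_y (Kreg (widen_ord (leqnSn m) i) ord_max
  (snoc (subT x y, s)) r * \1_(cube (-2) 0) y).
have [a a0 ka] := Rintegral_reflect_near0 k ltr01.
have at0 : (0 < @lebesgue_measure R `]0%R, (Num.min a tau)%R[%classic)%E.
  rewrite lebesgue_measure_itv/= lte_fin lt_min a0 tau0.
  by rewrite oppr0 adde0 lte_fin lt_min a0.
(* The admissible times form an interval of positive measure, so one of them satisfies the bound. *)
have [t] : exists2 t, `]0, Num.min a tau[%classic t &
    halfspace_cyl T ((x, s), t) ->
    `|velocity (@normal_datum R m) (widen_ord (leqnSn m) i) ((x, s), t)| <= M.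
  by apply: (ae_exists _ _ Vxs).
rewrite /= in_itv/= lt_min => /and3P[t0 ta ttau].
have [t01 tT] : 0 < t < 1 /\ (t%:E < T)%E by apply/tauP; rewrite t0.
move=> /(_ (conj s0 (conj t0 tT))) Vle.
pose W := \int[lebesgueT m]_y (partial (widen_ord (leqnSn m) i) (@Esol R m.+1)
  (snoc (subT x y, s)) * \1_(cube (-2) 0) y).
pose U := \int[@lebesgue_measure R]_(r in `]0, t[) k (t - r).
have velE : velocity (@normal_datum R m) (widen_ord (leqnSn m) i)
    ((x, s : R), t) = U + W by exact: velocity_normal_datum.
have {velE Vle}Vle : `|U + W| <= M by rewrite -velE; exact: Vle.
have U1 : `|U| <= 1 by apply: ka; rewrite t0.
have WN : N%:R * C <= W by apply: tangential_integral_ge => //; rewrite s0.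
(* The chain [N * C <= W <= M - U <= M + 1 < N * C] is contradictory. *)
move: Vle U1 WN MN; rewrite !ler_norml.
move: U W (N%:R * C) => U W NC; clear; lra.
Qed.
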